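(* Let $p$ be a prime. If $G=D_{2p^2}$, then \[ M_1(\mathcal{B}(G))=10p^8-18p^7+7p^6+9p^5-12p^4+9p^3+7p^2+2 \] and \[ M_2(\mathcal{B}(G))=10p^8-18p^7+7p^6+9p^5-16p^4+9p^3+7p^2+2. \] Further, $\frac{M_{2}(\mathcal{B}(G))}{|e(\mathcal{B}(G))|} \geq \frac{M_{1}(\mathcal{B}(G))}{|V(\mathcal{B}(G))|}$.
   Context: $D_{2n}=\langle a,b : a^n=b^2=1,\ bab=a^{-1}\rangle$ is the dihedral group of order $2n$. For a finite group $G$, $L(G)$ denotes the set of all subgroups of $G$. The subgroup generating bipartite graph $\mathcal{B}(G)$ is the simple undirected bipartite graph whose vertex set is the disjoint union $(G\times G)\sqcup L(G)$, where $(x,y)\in G\times G$ and $H\in L(G)$ are adjacent if and only if $H=\langle x,y\rangle$ (the subgroup generated by $x$ and $y$); there are no other edges. For a finite simple graph $\mathcal{G}$ with vertex set $V(\mathcal{G})$ and edge set $e(\mathcal{G})$, the first and second Zagreb indices are $M_1(\mathcal{G})=\sum_{v\in V(\mathcal{G})}\deg(v)^2$ and $M_2(\mathcal{G})=\sum_{uv\in e(\mathcal{G})}\deg(u)\deg(v)$. *)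

(* Defs.v *)
From HB Require Import structures.
From mathcomp Require Import all_boot all_order all_algebra.
From mathcomp Require Import all_fingroup all_solvable.

Set Implicit Arguments.
Unset Strict Implicit.
Unset Printing Implicit Defensive.

Record sgraph := SGraph {
  svertex : finType;
  sadj : rel svertex;
  sadj_sym : symmetric sadj;
  sadj_irrefl : irreflexive sadj
}.

Section Zagreb.
Variable g : sgraph.

Definition sdeg (v : svertex g) : nat := #|[set u | sadj v u]|.

(* Edges are unordered pairs, so each one is counted once. *)
Definition sedges : {set {set svertex g}} :=
  [set [set uv.1; uv.2] | uv : svertex g * svertex g & sadj uv.1 uv.2].

Definition zagreb1 : nat := \sum_(v : svertex g) sdeg v ^ 2.

Definition zagreb2 : nat := \sum_(e in sedges) \prod_(v in e) sdeg v.

End Zagreb.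

Section SubgroupGeneratingBipartite.
(* The group is the whole type [gT], so that [{group gT}] is its set of
   subgroups. *)
Variable gT : finGroupType.

Definition sgb_vertex : finType := ((gT * gT) + {group gT})%type.

Definition sgb_adj (u v : sgb_vertex) : bool :=
  match u, v with
  | inl (x, y), inr H | inr H, inl (x, y) => H == <<[set x; y]>>%G
  | _, _ => false
  end.

Lemma sgb_adj_sym : symmetric sgb_adj.
Proof. by move=> [[x y]|H] [[z t]|K]. Qed.

Lemma sgb_adj_irrefl : irreflexive sgb_adj.
Proof. by move=> [[x y]|H]. Qed.

Definition sgb_graph : sgraph := SGraph sgb_adj_sym sgb_adj_irrefl.

End SubgroupGeneratingBipartite.

(* Main.v *)
Require Import Defs.
From mathcomp Require Import all_boot all_order all_algebra.
From mathcomp Require Import all_fingroup all_solvable.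
From mathcomp Require Import ring zify.
Import GRing.Theory Num.Theory.

(** Every vertex (x, y) has degree 1 and every vertex H has as degree the number
phi(H) of pairs generating H. Hence each edge contributes phi(H) to M_2, where
H is its endpoint among the subgroups, so that M_2 = \sum_H phi(H)^2, and
M_1 = |G|^2 + M_2 (lemmas [zagreb2_sgb] and [zagreb1_sgb]). There are |G|^2
edges and |G|^2 + |L(G)| vertices, so after clearing denominators the
inequality between the two ratios says
(\sum_H phi(H))^2 <= |L(G)| * \sum_H phi(H)^2, which is the Cauchy-Schwarz
inequality; it holds in every finite group ([zagreb_ratio_sgb]).

It remains to compute \sum_H phi(H)^2 in a dihedral group with rotation group
C of order n. No list of the subgroups outside C is needed, because the sum is
also \sum_(x, y) phi(<x, y>). The pairs (x, y) with <x, y> not inside C are of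
three kinds: rotation and reflection, reflection and rotation, two reflections.
The maps (x, y) |-> (y, x) and (x, y) |-> (x * y, y) preserve the generated
subgroup and identify the second and the third kind with the first
([sum_pairs_dihedral]). For a rotation x of order d and a reflection t, the
subgroup <x, t> meets C in <x> and has order 2 d. It is generated by a rotation
u and a reflection v exactly when u generates <x> and v is one of the d
reflections of <x, t>, so that, with the three kinds again,
phi(<x, t>) = 3 d totient(d) ([genpairs_dihedral]). As C has totient(d)
elements of order d for each d dividing n, and one subgroup of order d, this
gives M_2 as a sum over the subgroups K of C of
phi(K)^2 + 9 n |K| totient(|K|)^2 ([zagreb2_dihedral]).

When n is a power of p, the subgroups of C form a chain, and a pair generates K
unless both entries lie in its maximal subgroup, so that
phi(K) = |K|^2 - (|K| / p)^2 for nontrivial K ([genpairs_cyclic_pgroup]). For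
n = p^2 the sum has three terms, which add up to the stated polynomial. *)

Set Implicit Arguments.
Unset Strict Implicit.
Unset Printing Implicit Defensive.

(** * Zagreb indices as sums over generating pairs *)

Section GeneratingPairs.
Variable gT : finGroupType.
Implicit Types (z : gT * gT) (H K : {group gT}).

Definition gen_pair z : {group gT} := <<[set z.1; z.2]>>%G.
Definition genpairs H : nat := #|[set z | gen_pair z == H]|.

Lemma gen_pair_sub z H : (gen_pair z \subset H) = (z.1 \in H) && (z.2 \in H).
Proof. by rewrite gen_subG subUset !sub1set. Qed.

(** Both readings of a sum over edges, by pairs and by subgroups; [P] allows the
sum to be restricted to the subgroups of a given subgroup. *)
Lemma sum_gen_pair (P : pred {group gT}) (F : {group gT} -> nat) :
  \sum_(z | P (gen_pair z)) F (gen_pair z) = \sum_(H | P H) genpairs H * F H.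
Proof.
rewrite (partition_big gen_pair P) //=; apply: eq_bigr => H PH.
rewrite (eq_bigr (fun=> F H)) => [|z /andP[_ /eqP->] //].
rewrite sum_nat_const; congr (_ * _).
apply: eq_card => z; rewrite -[LHS]/(P (gen_pair z) && (gen_pair z == H)) inE.
by case: eqP => [->|]; rewrite ?PH ?andbF.
Qed.

Lemma sdeg_pair z : @sdeg (sgb_graph gT) (inl z) = 1.
Proof.
rewrite /sdeg (_ : [set u | _] = [set inr (gen_pair z)]) ?cards1 //.
by apply/setP=> [[[u v]|H]]; case: z => x y; rewrite !inE.
Qed.

Lemma sdeg_subgroup H : @sdeg (sgb_graph gT) (inr H) = genpairs H.
Proof.
rewrite /sdeg /genpairs -[RHS](card_imset _ (@inl_inj _ {group gT})).
apply: eq_card => -[[x y]|K]; rewrite !inE /=.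
  by rewrite mem_imset ?inE 1?eq_sym //; apply: inl_inj.
by apply/esym/imsetP => -[].
Qed.

Definition sgb_edge z : {set svertex (sgb_graph gT)} :=
  [set inl z; inr (gen_pair z)].

Lemma sgb_edge_inj : injective sgb_edge.
Proof.
by move=> z t /setP/(_ (inl z)); rewrite !inE eqxx => /esym/orP[] // /eqP[->].
Qed.

Lemma sedges_sgb : sedges (sgb_graph gT) = sgb_edge @: setT.
Proof.
apply/setP=> e; apply/imsetP/imsetP=> [[[u v]] | [[x y] _ ->]].
  case: u v => [[x y]|H] [[x' y']|K] /[!inE] //= /eqP-> ->.
    by exists (x, y).
  by exists (x', y'); rewrite // setUC.
by exists (inl (x, y), inr (gen_pair (x, y))); rewrite ?inE /=.
Qed.

Lemma card_sedges_sgb : #|sedges (sgb_graph gT)| = #|gT| ^ 2.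
Proof.
rewrite sedges_sgb card_imset ?cardsT ?card_prod ?mulnn //.
exact: sgb_edge_inj.
Qed.

Lemma zagreb2_sgb_pairs :
  zagreb2 (sgb_graph gT) = \sum_z genpairs (gen_pair z).
Proof.
rewrite /zagreb2 sedges_sgb big_imset /=; last first.
  by move=> ? ? _ _; apply: sgb_edge_inj.
apply: eq_big => [z|z _]; first by rewrite inE.
rewrite big_setU1 ?inE //= big_set1.
by rewrite sdeg_pair sdeg_subgroup mul1n.
Qed.

Lemma zagreb2_sgb :
  zagreb2 (sgb_graph gT) = \sum_(H : {group gT}) genpairs H ^ 2.
Proof. by rewrite zagreb2_sgb_pairs (@sum_gen_pair predT). Qed.

Lemma zagreb1_sgb :
  zagreb1 (sgb_graph gT) = #|gT| ^ 2 + zagreb2 (sgb_graph gT).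
Proof.
rewrite zagreb2_sgb /zagreb1 big_sumType /=; congr (_ + _).
  rewrite (eq_bigr (fun=> 1)) => [|z _]; last by rewrite sdeg_pair.
  by rewrite sum1_card card_prod mulnn.
by apply: eq_bigr => H _; rewrite sdeg_subgroup.
Qed.

Lemma sum_genpairs : \sum_(H : {group gT}) genpairs H = #|gT| ^ 2.
Proof.
transitivity (\sum_(H : {group gT}) genpairs H * 1).
  by under [RHS]eq_bigr do rewrite muln1.
by rewrite -(@sum_gen_pair predT (fun=> 1)) sum1_card card_prod mulnn.
Qed.

End GeneratingPairs.

(** * The inequality between the ratios *)

(** Cauchy-Schwarz against the constant 1: twice both sides are double sums,
which compare termwise since 2 a b <= a^2 + b^2. *)
Lemma sqr_sum_leq (I : finType) (a : I -> nat) :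
  (\sum_i a i) ^ 2 <= #|I| * \sum_i a i ^ 2.
Proof.
suff: 2 * (\sum_i a i) ^ 2 <= 2 * (#|I| * \sum_i a i ^ 2) by rewrite leq_pmul2l.
have ->: 2 * (\sum_i a i) ^ 2 = \sum_i \sum_j 2 * (a i * a j).
  rewrite -mulnn big_distrlr big_distrr; apply: eq_bigr => i _.
  by rewrite big_distrr.
have ->: 2 * (#|I| * \sum_i a i ^ 2) = \sum_i \sum_j (a i ^ 2 + a j ^ 2).
  under [RHS]eq_bigr do rewrite big_split sum_nat_const /=.
  by rewrite big_split sum_nat_const -big_distrr /= mul2n addnn.
by apply: leq_sum => i _; apply: leq_sum => j _; rewrite nat_Cauchy.
Qed.

Local Open Scope ring_scope.

Lemma zagreb_ratio_sgb (gT : finGroupType) :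
  (zagreb1 (sgb_graph gT))%:R / #|svertex (sgb_graph gT)|%:R
    <= (zagreb2 (sgb_graph gT))%:R / #|sedges (sgb_graph gT)|%:R :> rat.
Proof.
have G_gt0 : (0 < #|gT|)%N by apply/card_gt0P; exists 1%g.
have oV : #|svertex (sgb_graph gT)| = (#|gT| ^ 2 + #|{group gT}|)%N.
  by rewrite card_sum card_prod mulnn.
have V_gt0 : (0 < #|svertex (sgb_graph gT)|)%N.
  by rewrite oV addn_gt0 expn_gt0 G_gt0.
rewrite card_sedges_sgb ler_pdivrMr ?ltr0n // mulrAC.
rewrite ler_pdivlMr ?ltr0n ?expn_gt0 ?G_gt0 //.
rewrite -!natrM ler_nat oV zagreb1_sgb.
have := sqr_sum_leq (@genpairs gT); rewrite sum_genpairs -zagreb2_sgb.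
by rewrite mulnDl mulnDr mulnn addnC leq_add2l [X in (_ <= X)%N]mulnC.
Qed.

Local Close Scope ring_scope.
Local Open Scope group_scope.

(** * Sums over cyclic groups *)

Section CyclicSubgroups.
Variables (gT : finGroupType) (C : {group gT}).
Hypothesis cycC : cyclic C.
Implicit Types K : {group gT}.

(** Group the elements by the subgroup that they generate: K has totient #|K|
generators. *)
Lemma sum_cyclic_order (F : nat -> nat) :
  (\sum_(x in C) F #[x] =
     \sum_(K : {group gT} | K \subset C) totient #|K| * F #|K|)%N.
Proof.
rewrite (partition_big (fun x => <[x]>%G) (fun K => K \subset C)) /=;
  last by move=> x Cx; rewrite cycle_subG.
apply: eq_bigr => K sKC.
rewrite (eq_bigr (fun=> F #|K|)) => [|x /andP[_ /eqP <-]] //.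
rewrite sum_nat_const; congr (_ * _)%N.
have /cyclicP[a defK] := cyclicS sKC cycC.
have -> : totient #|K| = #|[set x | generator K x]|.
  by rewrite defK; apply: totient_gen.
apply: eq_card => x; rewrite -[LHS]/((x \in C) && (<[x]>%G == K)) !inE.
rewrite /generator -val_eqE /= eq_sym andbC; case: eqP => //= defKx.
by rewrite (subsetP sKC) // defKx cycle_id.
Qed.

(** A cyclic group has exactly one subgroup of each order dividing its own. *)
Lemma sum_cyclic_pgroup_subgroups p k (F : nat -> nat) :
  prime p -> #|C| = (p ^ k)%N ->
  (\sum_(K : {group gT} | K \subset C) F #|K| = \sum_(i < k.+1) F (p ^ i))%N.
Proof.
move=> p_pr oC; have /cyclicP[a defC] := cycC.
have oa : #[a] = (p ^ k)%N by rewrite /order -defC.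
have oX (i : 'I_k.+1) : #|<[a ^+ (p ^ (k - i))]>| = (p ^ i)%N.
  by rewrite -[LHS]/#[_] (orderXexp _ oa) subKn // -ltnS.
rewrite (reindex_onto (fun i : 'I_k.+1 => <[a ^+ (p ^ (k - i))]>%G)
   (fun K => inord (logn p #|K|))) /=; last first.
  move=> K sKC; have /dvdn_pfactor : #|K| %| p ^ k by rewrite -oC cardSg.
  case=> // i le_ik oK; have lt_ik : i < k.+1 by [].
  apply/val_inj/eqP; rewrite /= (eq_subG_cyclic cycC) //.
    rewrite oX oK pfactorK // inordK //=.
  by rewrite defC cycle_subG mem_cycle.
apply: eq_big => [i|i _]; last by rewrite oX.
by rewrite oX pfactorK // inord_val eqxx defC cycle_subG mem_cycle.
Qed.

End CyclicSubgroups.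

(** The subgroups of K form a chain, so two elements fail to generate K exactly
when both lie in its maximal subgroup, of order #|K| %/ p. For trivial K there
is no such subgroup, but the formula still gives 1 because 1 %/ p is 0. *)
Lemma genpairs_cyclic_pgroup (gT : finGroupType) p (K : {group gT}) :
    prime p -> p.-group K -> cyclic K ->
  genpairs K = (#|K| ^ 2 - (#|K| %/ p) ^ 2)%N.
Proof.
move=> p_pr pK cycK; have [[|i] oK] := p_natP pK.
  have /eqP K1 : K :==: 1 by rewrite trivg_card1 oK.
  rewrite oK divn_small ?prime_gt1 // -[RHS](cards1 ((1, 1) : gT * gT)).
  apply: eq_card => -[x y]; rewrite !inE xpair_eqE -val_eqE /= K1 eqEsubset.
  by rewrite sub1G andbT gen_subG subUset !sub1set !inE.
have /cyclicP[c defK] := cycK.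
have oc : #[c] = (p ^ i.+1)%N by rewrite /order -defK.
pose M := <[c ^+ p]>%G.
have oM : #|M| = (p ^ i)%N.
  by rewrite -[LHS]/#[_] -[p]expn1 (orderXexp _ oc) subn1.
have sMK : M \subset K by rewrite defK cycleX.
have -> : #|K| %/ p = #|M| by rewrite oK oM expnS mulKn ?prime_gt0.
rewrite -!mulnn -!cardsX -cardsDS; last exact: setXS.
apply: eq_card => -[x y]; rewrite !inE -!(gen_pair_sub (x, y)).
set L := gen_pair _; apply/eqP/andP=> [-> | [nsLM sLK]].
  split=> //; apply/negP => /subset_leq_card.
  by rewrite oK oM leq_exp2l ?prime_gt1 // ltnn.
have /dvdn_pfactor : #|L| %| p ^ i.+1 by rewrite -oK cardSg.
case=> // j; rewrite leq_eqVlt => /predU1P[-> oL | lt_ji oL].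
  by apply/val_inj/eqP; rewrite eqEcard sLK oL oK /=.
case/negP: nsLM; rewrite -(cardSg_cyclic cycK) //.
by rewrite oL oM dvdn_exp2l.
Qed.

(** * Dihedral groups *)

(** Instead of an explicit presentation, the group of rotations C is only
assumed to be cyclic of index 2 with involutions outside it; this already
forces the elements outside C to invert those of C. *)
Section Dihedral.
Variables (gT : finGroupType) (C : {group gT}).
Hypotheses (cycC : cyclic C) (oG : #|gT| = (2 * #|C|)%N).
Hypothesis invol : forall t, t \notin C -> t ^+ 2 = 1.
Implicit Types (x u t v : gT) (K H : {group gT}) (z : gT * gT).

Lemma setC_rcoset t : t \notin C -> ~: C = C :* t.
Proof.
move=> nCt; apply/eqP; rewrite eq_sym eqEcard cardsCs setCK card_rcoset oG.
rewrite mul2n -addnn addnK leqnn andbT.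
apply/subsetP=> v; rewrite mem_rcoset inE => Cvt.
by apply: contra nCt => Cv; rewrite -groupV -(groupMl _ Cv).
Qed.

Lemma mulg_reflections u v : u \notin C -> v \notin C -> u * v \in C.
Proof.
move=> nCu nCv; have : u \in ~: C by rewrite inE.
by rewrite (@setC_rcoset v^-1) ?groupV // mem_rcoset invgK.
Qed.

(** Both t and x * t are involutions; x * t * (x * t) = 1 is x * x ^ t = 1. *)
Lemma reflection_inverts x t : x \in C -> t \notin C -> x ^ t = x^-1.
Proof.
move=> Cx nCt; have /invol : x * t \notin C by rewrite groupMl.
have tV : t^-1 = t by apply/eqP; rewrite eq_invg_mul; apply/eqP/invol.
rewrite expgS expg1 => xtxt; apply/eqP; rewrite eq_sym eq_invg_mul conjgE tV.
by rewrite -xtxt !mulgA.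
Qed.

Lemma reflection_gen x t : x \in C -> t \notin C ->
  gen_pair (x, t) = <[x]> * <[t]> :> {set gT}.
Proof.
move=> Cx nCt; rewrite /= -[LHS]joing_idl -joing_idr norm_joinEr //.
rewrite cycle_subG; apply/normP; rewrite -cycleJ.
by rewrite reflection_inverts // cycleV.
Qed.

Lemma order_reflection t : t \notin C -> #[t] = 2.
Proof.
move=> nCt; apply: nt_prime_order; rewrite ?invol //.
by apply: contraNneq nCt => ->.
Qed.

Lemma rotation_reflection_TI t : t \notin C -> C :&: <[t]> = 1.
Proof.
move=> nCt; rewrite setIC prime_TIg ?cycle_subG //.
by rewrite -[#|_|]/#[t] order_reflection.
Qed.

Lemma reflection_genI x t : x \in C -> t \notin C ->
  gen_pair (x, t) :&: C = <[x]>.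
Proof.
move=> Cx nCt; rewrite reflection_gen // -group_modl ?cycle_subG //.
by rewrite setIC rotation_reflection_TI ?mulg1.
Qed.

Lemma card_reflection_gen x t : x \in C -> t \notin C ->
  #|gen_pair (x, t)| = (2 * #[x])%N.
Proof.
move=> Cx nCt; rewrite reflection_gen // TI_cardMg.
  by rewrite -[#|<[t]>%G|]/#[t] order_reflection // mulnC.
by apply/trivgP; rewrite -(rotation_reflection_TI nCt) setSI ?cycle_subG.
Qed.

(** One direction intersects with C, which recovers <u> and <x> from the two
subgroups; the other compares orders. *)
Lemma eq_reflection_gen x t u v :
    x \in C -> t \notin C -> u \in C -> v \notin C ->
  (gen_pair (u, v) == gen_pair (x, t)) =
     generator <[x]> u && (v \in gen_pair (x, t)).
Proof.
move=> Cx nCt Cu nCv; apply/eqP/andP=> [eqH | [/eqP eqxu Hv]].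
  split; last by rewrite -eqH mem_gen ?inE ?eqxx ?orbT.
  by rewrite /generator -(@reflection_genI x t) // -eqH reflection_genI.
apply/val_inj/eqP; rewrite eqEcard gen_pair_sub Hv andbT.
rewrite !card_reflection_gen // /order -eqxu leqnn andbT.
have /subsetP-> // : <[x]> \subset gen_pair (x, t).
  by rewrite -(reflection_genI Cx nCt) subsetIl.
by rewrite eqxu cycle_id.
Qed.

(** The pairs not contained in C fall into three classes, and (u, v) |-> (v, u)
and (u, v) |-> (u * v, v) map two of them onto the pairs of a rotation and a
reflection without changing the generated subgroup. *)
Lemma sum_pairs_dihedral (F : {group gT} -> nat) :
  (\sum_z F (gen_pair z) =
    \sum_(z | gen_pair z \subset C) F (gen_pair z) +
    3 * \sum_(x in C) \sum_(t | t \notin C) F (gen_pair (x, t)))%N.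
Proof.
rewrite (eq_bigl _ _ (fun z => gen_pair_sub z C)).
rewrite (bigID (fun z => (z.1 \in C) && (z.2 \in C))) /=; congr (_ + _)%N.
rewrite pair_big /=; set S := (X in _ = (3 * X)%N).
have eqS : S = (\sum_(z | (z.1 \in C) && (z.2 \notin C)) F (gen_pair z))%N.
  by apply: eq_bigr; case.
rewrite (bigID (fun z => z.1 \in C)) /=.
rewrite (bigID (fun z => z.2 \in C) (fun z => _ && (z.1 \notin C))) /=.
rewrite mulSn mul2n -addnn; congr (_ + (_ + _))%N.
- rewrite eqS; apply: eq_bigl => z.
  by case: (z.1 \in C); rewrite ?andbF ?andbT.
- rewrite eqS (reindex_inj (can_inj (@swap_pairK _ _))) /=.
  apply: eq_big => [[x t]|[x t] _]; rewrite /swap_pair /=.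
    by do 2!case: (_ \in C).
  by rewrite /gen_pair /= setUC.
rewrite eqS; pose f z := (z.1 * z.2, z.2).
have fK : cancel f (fun z => (z.1 * z.2^-1, z.2)).
  by case=> u v; rewrite /f /= mulgK.
rewrite [RHS](reindex_inj (can_inj fK)) /=.
apply: eq_big => [[u v]|[u v] _]; rewrite /f /=.
  case: (boolP (v \in C)) => nCv; rewrite ?andbF ?andbT //=.
  have [Cu | nCu] := boolP (u \in C); last by rewrite mulg_reflections.
  by rewrite groupMl // (negbTE nCv).
congr F; apply/val_inj/eqP; rewrite eqEsubset !gen_pair_sub /=.
apply/andP; split; apply/andP; split; try by rewrite mem_gen ?set22.
  by rewrite -[X in X \in _](mulgK v u) groupM ?groupV ?mem_gen ?set21 ?set22.
by rewrite groupM ?mem_gen ?set21 ?set22.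
Qed.

(** Counting the pairs that generate H is itself a sum over all pairs, of the
indicator of H, so [sum_pairs_dihedral] reduces it to the pairs (u, v) of
[eq_reflection_gen]: totient #[x] choices for u and #[x] for v. *)
Lemma genpairs_dihedral x t : x \in C -> t \notin C ->
  genpairs (gen_pair (x, t)) = (3 * (totient #[x] * #[x]))%N.
Proof.
move=> Cx nCt; set H := gen_pair (x, t).
have HnC : H \subset C = false by rewrite gen_pair_sub /= (negbTE nCt) andbF.
rewrite /genpairs cardsE -sum1_card big_mkcond.
rewrite (sum_pairs_dihedral (fun K => if K == H then 1 else 0)%N).
rewrite big1 ?add0n => [|z sC]; last first.
  by case: eqP => // eqH; rewrite eqH HnC in sC.
congr (3 * _)%N.
transitivity (#|[set u | generator <[x]> u]| * #|H :\: C|)%N.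
  rewrite pair_big -big_mkcondr /= sum1_card -cardsX.
  apply: eq_card => -[u v].
  rewrite -[LHS]/((u \in C) && (v \notin C) && (gen_pair (u, v) == H)) !inE.
  have [Cu|nCu] /= := boolP (u \in C); last first.
    apply/esym/negbTE; apply: contra nCu => /andP[/cycle_generator xu _].
    by apply: subsetP xu; rewrite cycle_subG.
  have [Cv|nCv] /= := boolP (v \in C); first by rewrite andbF.
  by rewrite eq_reflection_gen.
rewrite -totient_gen cardsD reflection_genI // card_reflection_gen //.
by rewrite -orderE mul2n -addnn addnK.
Qed.

(** The second term of the summand for K comes from the pairs that generate a
subgroup not contained in C but meeting C in K. *)
Lemma zagreb2_dihedral :
  zagreb2 (sgb_graph gT) =
  (\sum_(K : {group gT} | K \subset C)
     (genpairs K ^ 2 + 9 * #|C| * (#|K| * totient #|K| ^ 2)))%N.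
Proof.
rewrite zagreb2_sgb_pairs sum_pairs_dihedral.
rewrite (sum_gen_pair (fun K => K \subset C) (@genpairs gT)).
rewrite big_split; congr (_ + _)%N.
have oR : #|[pred t | t \notin C]| = #|C|.
  by have := cardC C; rewrite oG mul2n -addnn => /addnI.
transitivity (3 * \sum_(x in C) #|C| * (3 * (totient #[x] * #[x])))%N.
  congr (3 * _)%N; apply: eq_bigr => x Cx.
  rewrite (eq_bigr (fun=> 3 * (totient #[x] * #[x])))%N; last first.
    by move=> t /genpairs_dihedral->.
  by rewrite sum_nat_const oR.
rewrite (sum_cyclic_order cycC (fun d => #|C| * (3 * (totient d * d)))%N).
rewrite big_distrr; apply: eq_bigr => K _ /=; ring.
Qed.

End Dihedral.

(** The presentation makes every element x^i or x^i * y, and (x^i * y)^2 = 1.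
That the rotation x really has order q follows by counting: <x><y> is all of a
group of order 2 q. *)
Lemma dihedral_rotations q (gT : finGroupType) :
    1 < q -> [set: gT] \isog 'D_(2 * q) ->
  exists C : {group gT}, [/\ cyclic C, #|C| = q, #|gT| = (2 * #|C|)%N
    & forall t, t \notin C -> t ^+ 2 = 1].
Proof.
rewrite mul2n => q_gt1 isoD.
have oG : #|[set: gT]| = q.*2 by rewrite (card_isog isoD) card_dihedral.
case/(isoGrpP _ (Grp_dihedral q_gt1)): isoD => _.
case/existsP=> -[x y] /= /eqP[defG xq y2 xy].
have nxy : y \in 'N(<[x]>) by apply/normP; rewrite -cycleJ xy cycleV.
have {}defG : <[x]> * <[y]> = [set: gT].
  by rewrite -norm_joinEr ?cycle_subG // -defG joing_idl joing_idr.
have le_xq : #[x] <= q by rewrite dvdn_leq ?order_dvdn ?xq // ltnW.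
have le_y2 : #[y] <= 2 by rewrite dvdn_leq ?order_dvdn ?y2.
have ox : #[x] = q.
  apply/eqP; rewrite eqn_leq le_xq -(leq_pmul2r (isT : 0 < 2)) muln2 -oG -defG.
  apply: (@leq_trans (#[x] * #[y])%N); last by rewrite leq_mul2l le_y2 orbT.
  by rewrite /order mul_cardG leq_pmulr ?cardG_gt0.
exists <[x]>%G; split; rewrite ?cycle_cyclic //= -?[#|<[x]>|]/#[x] ?ox //.
  by rewrite -cardsT oG mul2n.
move=> t nxt; have : t \in <[x]> * <[y]> by rewrite defG inE.
case/mulsgP=> _ _ /cycleP[i ->] /cycleP[j ->] def_t.
have y2j k : y ^+ (2 * k) = 1 by rewrite expgM y2 expg1n.
have {nxt}def_t : t = x ^+ i * y.
  move: nxt; rewrite def_t -(odd_double_half j) expgD -mul2n y2j mulg1.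
  by case: (odd j) => //; rewrite mulg1 mem_cycle.
rewrite def_t expgS expg1 [X in X * _ = _]conjgC conjXg xy expVgn -mulgA mulKg.
exact: y2.
Qed.

(** * Dihedral groups of order twice a prime power *)

Lemma zagreb2_dihedral_prime_power p k (gT : finGroupType) :
    prime p -> 0 < k -> [set: gT] \isog 'D_(2 * p ^ k) ->
  zagreb2 (sgb_graph gT) =
    (\sum_(i < k.+1) (((p ^ i) ^ 2 - (p ^ i %/ p) ^ 2) ^ 2 +
                      9 * p ^ k * (p ^ i * totient (p ^ i) ^ 2)))%N.
Proof.
move=> p_pr k_gt0 /dihedral_rotations[|C [cycC oC oG invol]].
  by rewrite -(expn0 p) ltn_exp2l ?prime_gt1.
rewrite (zagreb2_dihedral cycC) // oC -(sum_cyclic_pgroup_subgroups cycC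
  (fun d => (d ^ 2 - (d %/ p) ^ 2) ^ 2 + 9 * p ^ k * (d * totient d ^ 2))%N
  p_pr oC).
apply: eq_bigr => K sKC; congr (_ ^ 2 + _)%N.
apply: genpairs_cyclic_pgroup => //; last exact: cyclicS cycC.
by apply: pgroupS sKC _; rewrite /pgroup oC pnatX pnat_id.
Qed.

Local Close Scope group_scope.
Local Open Scope ring_scope.
Unset Implicit Arguments.

Theorem theorem3p7 (p : nat) (gT : finGroupType) (p_prime : prime p)
    (isoD : [set: gT] \isog 'D_(2 * p ^ 2)) :
  [/\ (zagreb1 (sgb_graph gT))%:Z =
        10 * p%:Z ^+ 8 - 18 * p%:Z ^+ 7 + 7 * p%:Z ^+ 6 + 9 * p%:Z ^+ 5
        - 12 * p%:Z ^+ 4 + 9 * p%:Z ^+ 3 + 7 * p%:Z ^+ 2 + 2,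
      (zagreb2 (sgb_graph gT))%:Z =
        10 * p%:Z ^+ 8 - 18 * p%:Z ^+ 7 + 7 * p%:Z ^+ 6 + 9 * p%:Z ^+ 5
        - 16 * p%:Z ^+ 4 + 9 * p%:Z ^+ 3 + 7 * p%:Z ^+ 2 + 2
    & (zagreb2 (sgb_graph gT))%:R / #|sedges (sgb_graph gT)|%:R
        >= (zagreb1 (sgb_graph gT))%:R / #|svertex (sgb_graph gT)|%:R :> rat].
Proof.
have p_gt1 := prime_gt1 p_prime.
have oG : #|gT| = (2 * p ^ 2)%N.
  have [|C [_ oC -> _]] := dihedral_rotations _ isoD; last by rewrite oC.
  by rewrite (ltn_exp2l 0).
have M2E : (zagreb2 (sgb_graph gT))%:Z =
    10 * p%:Z ^+ 8 - 18 * p%:Z ^+ 7 + 7 * p%:Z ^+ 6 + 9 * p%:Z ^+ 5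
    - 16 * p%:Z ^+ 4 + 9 * p%:Z ^+ 3 + 7 * p%:Z ^+ 2 + 2.
  rewrite (zagreb2_dihedral_prime_power p_prime _ isoD) //.
  rewrite !big_ord_recr big_ord0.
  have totp e : totient (p ^ e.+1) = (p.-1 * p ^ e)%N.
    by rewrite totient_pfactor.
  have divp e : (p ^ e.+1 %/ p = p ^ e)%N by rewrite expnS mulKn ?prime_gt0.
  rewrite /= divn_small // !totp !divp expn0 expn1.
  (* With p = q + 1 the truncated differences factor into products, which can be
     sent to the integers. *)
  case: p p_gt1 {p_prime isoD oG totp divp} => // q _ /=.
  have -> : (q.+1 ^ 2 - 1 ^ 2 = q * q.+2)%N by rewrite subn_sqr subn1 addn1.
  have -> : ((q.+1 ^ 2) ^ 2 - q.+1 ^ 2 = q.+1 ^ 2 * (q * q.+2))%N.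
    by rewrite subn_sqr -mulnn; nia.
  rewrite -[totient 1]/1%N -[(1 ^ 2 - 0 ^ 2)%N]/1%N; ring.
split; last exact: zagreb_ratio_sgb.
- by rewrite zagreb1_sgb PoszD M2E oG; ring.
- exact: M2E.
Qed.
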